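(* Let $R$ be a noetherian left Bézout ring (a domain), let $\mathsf R$ be a multivariate Ore extension of $R$, and let $\mathsf I\subset\mathsf R^m$ be a left (resp. bilateral) module. For each $\tau\in\mathcal T^{(m)}$ let $\mathsf I_\tau:=\{\mathrm{lc}(f):f\in\mathsf I,\ \mathbf T(f)=\tau\}\cup\{0\}$, a left ideal of $R$, and let $c_\tau\in R$ be such that $\mathsf I_\tau=\mathbb I_L(c_\tau)$. Let $\mathsf T\subset\mathcal T^{(m)}$ be the set of all $\tau\in\mathcal T^{(m)}$ such that $c_\tau$ does not belong to the left ideal of $R$ generated by all elements $\alpha_\lambda(c_\omega)$ with $\omega\in\mathcal T^{(m)}$, $\omega\ne\tau$, $\lambda,\rho\in\mathcal T$, $\tau=\lambda\circ\omega\circ\rho$ (with $\rho=1$ in the left case). For each $\tau\in\mathsf T$ fix any element $f_\tau\in\mathsf I$ with $\mathbf M(f_\tau)=c_\tau\tau$. Then $S_w:=\{f_\tau:\tau\in\mathsf T\}$ is a left (resp. bilateral) weak Gröbner basis of $\mathsf I$.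
   Context: A ring is left Bézout if every finitely generated left ideal is principal; $\mathbb I_L(c)$ is the left ideal generated by $c$. **Ore extensions.** $R$ is a (not necessarily commutative) domain with identity. A multivariate Ore extension $\mathsf R=R[Y_1;\alpha_1,\delta_1]\cdots[Y_n;\alpha_n,\delta_n]$ is an iterated Ore extension ($Y_i\star r=\alpha_i(r)Y_i+\delta_i(r)$, $\alpha_i$ an injective ring endomorphism mapping $R$ to $R$, $\delta_i$ an $\alpha_i$-derivation mapping $R$ to $R$, i.e. additive with $\delta_i(rr')=\alpha_i(r)\delta_i(r')+\delta_i(r)r'$) such that $\alpha_j\delta_i=\delta_i\alpha_j$ for $i\ne j$, $\alpha_i\alpha_j=\alpha_j\alpha_i$, $\delta_i\delta_j=\delta_j\delta_i$, and $\alpha_j(Y_i)=Y_i$, $\delta_j(Y_i)=0$ for $i<j$. Its multiplication is $\star$. It is a free left $R$-module on the terms $\mathcal T=\{Y_1^{a_1}\cdots Y_n^{a_n}\}$, a commutative monoid with product $\circ$. For $\tau=Y_1^{a_1}\cdots Y_n^{a_n}$, $\alpha_\tau=\alpha_1^{a_1}\cdots\alpha_n^{a_n}:R\to R$. The associated graded ring has the same left $R$-module with product $(a\tau)\ast(b\omega)=a\alpha_\tau(b)\,\tau\circ\omega$. **Orderings.** $\mathsf R^m$ has canonical basis $\mathbf e_i$ (with $r\star(s\mathbf e_i)\star t=(r\star s\star t)\mathbf e_i$) and terms $\mathcal T^{(m)}=\{t\mathbf e_i\}$. Fix a term ordering $\prec$ on $\mathcal T$ and a compatible term ordering $<$ on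 $\mathcal T^{(m)}$: a well-ordering with $\omega_1\prec\omega_2\Rightarrow\omega_1t<\omega_2t$ and $t_1<t_2\Rightarrow\omega t_1<\omega t_2$. $\mathbf T(f)$, $\mathrm{lc}(f)$, $\mathbf M(f)=\mathrm{lc}(f)\mathbf T(f)$: maximal term, leading coefficient, maximal monomial. **Weak Gröbner basis.** $G\subset\mathsf I\setminus\{0\}$ is a bilateral weak Gröbner basis of the bilateral module $\mathsf I$ if for every $f\in\mathsf I\setminus\{0\}$, $\mathbf M(f)=\sum_ia_i\lambda_i\ast\mathbf M(g_i)\ast b_i\rho_i$ (finite sum) with $g_i\in G$, $a_i,b_i\in R\setminus\{0\}$, $\lambda_i,\rho_i\in\mathcal T$, $\lambda_i\circ\mathbf T(g_i)\circ\rho_i=\mathbf T(f)$; left weak Gröbner basis: the same with all $b_i=1$, $\rho_i=1$. *)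

(* Defs.v *)
From HB Require Import structures.
From mathcomp Require Import all_boot all_order all_algebra.
From mathcomp Require Import mpoly.

Set Implicit Arguments.
Unset Strict Implicit.
Unset Printing Implicit Defensive.

Import GRing.Theory.
Local Open Scope ring_scope.

(* Subsets of rings and modules are Prop-valued predicates, and rings need not
   be commutative. *)
Definition left_ideal (R : nzRingType) (J : R -> Prop) : Prop :=
  [/\ J 0, forall x y, J x -> J y -> J (x + y) & forall r x, J x -> J (r * x)].

Definition left_span (R : nzRingType) (A : R -> Prop) (x : R) : Prop :=
  exists (k : nat) (r a : 'I_k -> R),
    (forall i, A (a i)) /\ x = \sum_(i < k) r i * a i.

Definition principal_left_ideal (R : nzRingType) (c : R) : R -> Prop :=
  left_span (fun a => a = c).

Definition left_bezout (R : nzRingType) : Prop :=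
  forall s : seq R, exists c : R,
    forall x, left_span (fun a => a \in s) x <-> principal_left_ideal c x.

Definition left_noetherian (R : nzRingType) : Prop :=
  forall J : nat -> R -> Prop,
    (forall k, left_ideal (J k)) ->
    (forall k x, J k x -> J k.+1 x) ->
    exists N, forall k x, (N <= k)%N -> J k x -> J N x.

(* R^c is the converse ring, whose left ideals are the right ideals of R. *)
Definition noetherian (R : nzRingType) : Prop :=
  left_noetherian R /\ left_noetherian R^c.

Record ore_data (R : nzRingType) (n : nat) := OreData {
  ore_alpha : 'I_n -> {rmorphism R -> R};
  ore_delta : 'I_n -> {additive R -> R};
  ore_alpha_inj : forall i, injective (ore_alpha i);
  ore_deltaM : forall i x y,
    ore_delta i (x * y) = ore_alpha i x * ore_delta i y + ore_delta i x * y;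
  ore_alphaC : forall i j x,
    ore_alpha i (ore_alpha j x) = ore_alpha j (ore_alpha i x);
  ore_deltaC : forall i j x,
    ore_delta i (ore_delta j x) = ore_delta j (ore_delta i x);
  ore_alpha_delta : forall i j x, i != j ->
    ore_alpha j (ore_delta i x) = ore_delta i (ore_alpha j x)
}.

Section OreMul.
Variables (R : nzRingType) (n : nat) (D : ore_data R n).
Implicit Types (p q : {mpoly R[n]}) (t s : 'X_{1..n}).

(* q |-> Y_i * q, i.e. Y_i * (b t) = alpha_i(b) Y_i t + delta_i(b) t. *)
Definition ore_act (i : 'I_n) q : {mpoly R[n]} :=
  \sum_(t <- msupp q)
     (ore_alpha D i q@_t *: 'X_[t + U_(i)] + ore_delta D i q@_t *: 'X_[t]).

(* q |-> Y_1^(t_1) * (... * (Y_n^(t_n) * q)) *)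
Definition ore_term_act t q : {mpoly R[n]} :=
  foldr (fun i r => iter (t i) (ore_act i) r) q (enum 'I_n).

Definition ore_mul p q : {mpoly R[n]} :=
  \sum_(t <- msupp p) p@_t *: ore_term_act t q.

(* alpha_1^(t_1) o ... o alpha_n^(t_n) *)
Definition alpha_term t (r : R) : R :=
  foldr (fun i x => iter (t i) (ore_alpha D i) x) r (enum 'I_n).

(* The product of the associated graded ring: the biadditive extension of
   (a t) . (b s) = a alpha_t(b) (t s). *)
Definition graded_mul p q : {mpoly R[n]} :=
  \sum_(t <- msupp p) \sum_(s <- msupp q)
     (p@_t * alpha_term t q@_s) *: 'X_[t + s].

End OreMul.

Section Ext.
Variables (R : nzRingType) (n : nat) (V : zmodType).
Implicit Types (p q : {mpoly R[n]}) (t s : 'X_{1..n}).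
Variable f : 'X_{1..n} -> R -> V.
Hypothesis fD : forall t, {morph f t : x y / x + y}.

Lemma ext_f0 t : f t 0 = 0.
Proof. by apply: (addrI (f t 0)); rewrite -fD !addr0. Qed.

Lemma ext_sub p (r : seq 'X_{1..n}) : uniq r -> {subset msupp p <= r} ->
  \sum_(t <- msupp p) f t p@_t = \sum_(t <- r) f t p@_t.
Proof.
move=> ur sub; rewrite (bigID (fun t => t \in msupp p) _ (r := r)) /=.
rewrite [X in _ = _ + X]big1_seq ?addr0; last first.
  by move=> t /andP[/memN_msupp_eq0-> _]; exact: ext_f0.
rewrite -[in RHS]big_filter; apply: perm_big; apply: uniq_perm => //.
- exact: filter_uniq.
by move=> t; rewrite mem_filter; case: (boolP (t \in msupp p)) => // /sub ->.
Qed.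

Lemma extD p q :
  \sum_(t <- msupp (p + q)) f t (p + q)@_t =
  \sum_(t <- msupp p) f t p@_t + \sum_(t <- msupp q) f t q@_t.
Proof.
pose r := undup (msupp p ++ msupp q).
have ur : uniq r by exact: undup_uniq.
rewrite (ext_sub (p := p + q) ur); last first.
  by move=> t /msuppD_le; rewrite mem_undup.
rewrite (ext_sub (p := p) ur); last first.
  by move=> t tp; rewrite mem_undup mem_cat tp.
rewrite (ext_sub (p := q) ur); last first.
  by move=> t tp; rewrite mem_undup mem_cat tp orbT.
by rewrite -big_split; apply: eq_bigr => t _; rewrite mcoeffD fD.
Qed.

Lemma extX c t :
  \sum_(s <- msupp (c *: 'X_[t])) f s (c *: 'X_[t])@_s = f t c.
Proof.
rewrite (@ext_sub _ [:: t]) // ?big_seq1 ?mcoeffZ ?mcoeffX ?eqxx ?mulr1 //.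
by move=> s /msuppZ_le; rewrite msuppX.
Qed.

End Ext.

Section Agree.
Variables (R : nzRingType) (n : nat) (V : zmodType).

Lemma mpoly_eq_on_terms_in (P : 'X_{1..n} -> Prop) (F G : {mpoly R[n]} -> V) :
  {morph F : x y / x + y} -> {morph G : x y / x + y} ->
  (forall c t, P t -> F (c *: 'X_[t]) = G (c *: 'X_[t])) ->
  forall p, (forall t, t \in msupp p -> P t) -> F p = G p.
Proof.
move=> FD GD FG p; rewrite [in F p](mpolyE p) [in G p](mpolyE p).
have F0 : F 0 = 0 by apply: (addrI (F 0)); rewrite -FD !addr0.
have G0 : G 0 = 0 by apply: (addrI (G 0)); rewrite -GD !addr0.
elim: (msupp p) => [|t l IH] Pl; rewrite ?big_nil ?big_cons ?F0 ?G0 //.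
rewrite FD GD FG ?IH // => [s sl|]; apply: Pl; rewrite inE ?eqxx //.
by rewrite sl orbT.
Qed.

Lemma mpoly_eq_on_terms (F G : {mpoly R[n]} -> V) :
  {morph F : x y / x + y} -> {morph G : x y / x + y} ->
  (forall c t, F (c *: 'X_[t]) = G (c *: 'X_[t])) -> F =1 G.
Proof.
by move=> FD GD FG p; apply: (@mpoly_eq_on_terms_in (fun=> True)).
Qed.

End Agree.

Section OreMulTheory.
Variables (R : nzRingType) (n : nat) (D : ore_data R n).
Implicit Types (p q r : {mpoly R[n]}) (t s : 'X_{1..n}).
Local Notation act := (ore_act D).
Local Notation tact := (ore_term_act D).
Local Notation "p ** q" := (ore_mul D p q) (at level 40).

Lemma ore_actD i : {morph act i : p q / p + q}.
Proof.
move=> p q; apply: (extD (f := fun t b =>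
  ore_alpha D i b *: 'X_[t + U_(i)] + ore_delta D i b *: 'X_[t])) => t x y.
by rewrite !raddfD /= !scalerDl addrACA.
Qed.

Lemma ore_actX i c t :
  act i (c *: 'X_[t]) =
  ore_alpha D i c *: 'X_[t + U_(i)] + ore_delta D i c *: 'X_[t].
Proof.
apply: (extX (f := fun t b =>
  ore_alpha D i b *: 'X_[t + U_(i)] + ore_delta D i b *: 'X_[t])) => s x y.
by rewrite !raddfD /= !scalerDl addrACA.
Qed.

Lemma ore_actZ i c p :
  act i (c *: p) = ore_alpha D i c *: act i p + ore_delta D i c *: p.
Proof.
move: p; apply: mpoly_eq_on_terms => [p q|p q|b t].
- by rewrite scalerDr ore_actD.
- by rewrite ore_actD !scalerDr addrACA.
rewrite scalerA !ore_actX rmorphM /= ore_deltaM scalerDr !scalerA scalerDl.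
by rewrite addrA.
Qed.

Lemma ore_actC i j p : act i (act j p) = act j (act i p).
Proof.
case: (eqVneq i j) => [->//|ij]; move: p.
apply: mpoly_eq_on_terms => [p q|p q|b t]; rewrite ?ore_actD //.
rewrite !ore_actX !ore_actD !ore_actX (ore_alphaC _ i j) (ore_deltaC _ i j).
rewrite (ore_alpha_delta _ _ ij) -(ore_alpha_delta D b (i := j) (j := i)) 1?eq_sym //.
by rewrite !addrA -!addmA [(U_(i) + _)%MM]addmC -!addrA; congr (_ + _); rewrite addrCA.
Qed.

Lemma iter_actD k i : {morph iter k (act i) : p q / p + q}.
Proof. by move=> p q; elim: k => //= k ->; rewrite ore_actD. Qed.

Lemma iter_actC k i j p : iter k (act i) (act j p) = act j (iter k (act i) p).
Proof. by elim: k => //= k ->; rewrite ore_actC. Qed.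

Lemma iter_actC2 k l i j p :
  iter k (act i) (iter l (act j) p) = iter l (act j) (iter k (act i) p).
Proof. by elim: l => //= l IH; rewrite iter_actC IH. Qed.

Lemma tactD t : {morph tact t : p q / p + q}.
Proof.
rewrite /ore_term_act => p q.
by elim: (enum _) => //= i e IH; rewrite IH iter_actD.
Qed.

Lemma tact_act t i p : tact t (act i p) = act i (tact t p).
Proof.
rewrite /ore_term_act.
by elim: (enum _) => //= j e IH; rewrite IH iter_actC.
Qed.

Lemma tact_add t s p : tact (t + s)%MM p = tact t (tact s p).
Proof.
rewrite /ore_term_act; elim: (enum _) => //= i e IH.
rewrite mnmDE iterD IH; congr iter.
move: (foldr _ p e) => q {IH}.
elim: e => //= j e IHe; by rewrite iter_actC2 IHe.
Qed.

Lemma tact0 p : tact 0%MM p = p.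
Proof. by rewrite /ore_term_act; elim: (enum _) => //= i e ->; rewrite mnm0E. Qed.

Lemma tactU i p : tact U_(i)%MM p = act i p.
Proof.
rewrite /ore_term_act.
have: uniq (enum 'I_n) by exact: enum_uniq.
have: i \in enum 'I_n by rewrite mem_enum.
have nil (e : seq 'I_n) : i \notin e ->
  foldr (fun j r => iter (U_(i)%MM j) (act j) r) p e = p.
  elim: e => //= j e IH; rewrite inE negb_or => /andP[ij /IH->].
  by rewrite mnm1E (negbTE ij).
elim: (enum _) => //= j e IH; rewrite inE => /orP[/eqP<-|ie] /andP[je ue].
  by rewrite nil // mnm1E eqxx.
rewrite IH // mnm1E; case: eqP => // ij; by rewrite -ij ie in je.
Qed.

Lemma tactX t s : tact t 'X_[s] = 'X_[t + s].
Proof.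
suff key (k : nat) : forall t s, mdeg t = k -> tact t 'X_[s] = 'X_[t + s].
  exact: key.
elim: k => [|k IH] {}t {}s.
  by move/eqP; rewrite mdeg_eq0 => /eqP->; rewrite tact0 add0m.
move=> dt; have: [exists i, t i != 0%N].
  apply: contra_eqT dt => /existsPn h; have -> : t = 0%MM.
    by apply/mnmP=> i; have /negPn/eqP-> := h i; rewrite mnm0E.
  by rewrite mdeg0.
case/existsP=> i ti; have le : (U_(i) <= t)%MM by rewrite lep1mP.
rewrite -(submK le) tact_add tactU -['X_[s]]scale1r ore_actX rmorph1 scale1r.
have -> : ore_delta D i 1 = 0.
  apply: (addrI (ore_delta D i 1)).
  by rewrite -{3}(mulr1 1) ore_deltaM rmorph1 mul1r mulr1 addr0.
rewrite scale0r addr0 IH; first by rewrite -addmA [(U_(i) + s)%MM]addmC.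
by move: dt; rewrite -{1}(submK le) mdegD mdeg1 addn1 => -[].
Qed.

Lemma ore_mulDl p q r : (p + q) ** r = p ** r + q ** r.
Proof.
by apply: (extD (f := fun t b => b *: tact t r)) => t x y; rewrite scalerDl.
Qed.

Lemma ore_mulDr p q r : p ** (q + r) = p ** q + p ** r.
Proof.
by rewrite /ore_mul -big_split; apply: eq_bigr => t _; rewrite tactD scalerDr.
Qed.

Lemma ore_mulX c t r : (c *: 'X_[t]) ** r = c *: tact t r.
Proof.
by apply: (extX (f := fun t b => b *: tact t r)) => s x y; rewrite scalerDl.
Qed.

Lemma ore_mulZ c p r : (c *: p) ** r = c *: (p ** r).
Proof.
move: p; apply: mpoly_eq_on_terms => [p q|p q|b t].
- by rewrite scalerDr ore_mulDl.
- by rewrite ore_mulDl scalerDr.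
by rewrite scalerA !ore_mulX scalerA.
Qed.

Lemma act_ore_mul i q r : act i q ** r = act i (q ** r).
Proof.
move: q; apply: mpoly_eq_on_terms => [p q|p q|b t].
- by rewrite ore_actD ore_mulDl.
- by rewrite ore_mulDl ore_actD.
by rewrite ore_actX ore_mulDl !ore_mulX ore_actZ addmC tact_add tactU.
Qed.

Lemma tact_ore_mul t q r : tact t q ** r = tact t (q ** r).
Proof.
rewrite /ore_term_act; elim: (enum _) => //= i e <-.
by elim: (t i) => //= k IH; rewrite act_ore_mul IH.
Qed.

Lemma ore_mulA : associative (ore_mul D).
Proof.
move=> p q r; move: p; apply: mpoly_eq_on_terms => [p p'|p p'|c t].
- by rewrite ore_mulDl.
- by rewrite !ore_mulDl.
by rewrite !ore_mulX ore_mulZ tact_ore_mul.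
Qed.

Lemma ore_mul1l : left_id ('X_[0]) (ore_mul D).
Proof. by move=> p; rewrite -['X_[0]]scale1r ore_mulX tact0 scale1r. Qed.

Lemma ore_mul_term p s : p ** 'X_[s] = p * 'X_[s].
Proof.
move: p; apply: mpoly_eq_on_terms => [p q|p q|b t].
- by rewrite ore_mulDl.
- by rewrite mulrDl.
by rewrite ore_mulX tactX -scalerAl mpolyXD.
Qed.

Lemma ore_mul1r : right_id ('X_[0]) (ore_mul D).
Proof. by move=> p; rewrite ore_mul_term mpolyX0 mulr1. Qed.

Lemma ore_one_neq0 : 'X_[0] != 0 :> {mpoly R[n]}.
Proof. by rewrite mpolyX0 oner_neq0. Qed.

End OreMulTheory.

(* The multivariate Ore extension R[Y_1; alpha_1, delta_1]...[Y_n; ...]: the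
   free left R-module on the terms, with the product ore_mul.  Lemma
   ore_ext_tower below shows that it is an iterated Ore extension. *)
Definition ore_ext (R : nzRingType) (n : nat) (D : ore_data R n) : Type :=
  {mpoly R[n]}.

HB.instance Definition _ (R : nzRingType) n (D : ore_data R n) :=
  GRing.Lmodule.on (ore_ext D).
HB.instance Definition _ (R : nzRingType) n (D : ore_data R n) :=
  GRing.Zmodule_isNzRing.Build (ore_ext D) (@ore_mulA R n D) (@ore_mul1l R n D)
    (@ore_mul1r R n D) (@ore_mulDl R n D) (@ore_mulDr R n D)
    (@ore_one_neq0 R n).


Definition subring (S : nzRingType) (A : S -> Prop) : Prop :=
  [/\ A 1, forall x y, A x -> A y -> A (x - y)
     & forall x y, A x -> A y -> A (x * y)].

(* B = A[Y; a, d] for subrings A and B of S; the values of a and d outside A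
   are irrelevant. *)
Record is_ore_extension (S : nzRingType) (A B : S -> Prop) (Y : S)
    (a d : S -> S) : Prop := IsOreExtension {
  ore_base_subring : subring A;
  ore_top_subring : subring B;
  ore_endo : forall x, A x -> A (a x);
  ore_endo1 : a 1 = 1;
  ore_endoD : forall x y, A x -> A y -> a (x + y) = a x + a y;
  ore_endoM : forall x y, A x -> A y -> a (x * y) = a x * a y;
  ore_endo_inj : forall x y, A x -> A y -> a x = a y -> x = y;
  ore_der : forall x, A x -> A (d x);
  ore_derD : forall x y, A x -> A y -> d (x + y) = d x + d y;
  ore_derM : forall x y, A x -> A y -> d (x * y) = a x * d y + d x * y;
  ore_comm : forall x, A x -> Y * x = a x * Y + d x;
  ore_gen : forall b, B b <->
    exists (k : nat) (s : 'I_k -> S),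
      (forall j, A (s j)) /\ b = \sum_(j < k) s j * Y ^+ j;
  ore_free : forall k (s : 'I_k -> S), (forall j, A (s j)) ->
    \sum_(j < k) s j * Y ^+ j = 0 -> forall j, s j = 0
}.

Section OreTower.
Variables (R : nzRingType) (n : nat) (D : ore_data R n).
Implicit Types (p q : ore_ext D) (t : 'X_{1..n}).

Definition ore_const (r : R) : ore_ext D := (r *: 'X_[0] : {mpoly R[n]}).
Definition ore_var (i : 'I_n) : ore_ext D := ('X_i : {mpoly R[n]}).

(* R[Y_1; alpha_1, delta_1]...[Y_k; alpha_k, delta_k] *)
Definition ore_stage (k : nat) p : Prop :=
  forall t (i : 'I_n), (k <= i)%N -> t i != 0%N -> mcoeff t p = 0.

(* The extension of alpha_i to the i-th ring of the tower with
   alpha_i(Y_j) = Y_j, and that of delta_i with delta_i(Y_j) = 0, j < i. *)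
Definition ore_endo_ext (i : 'I_n) p : ore_ext D := map_mpoly (ore_alpha D i) p.
Definition ore_der_ext (i : 'I_n) p : ore_ext D := map_mpoly (ore_delta D i) p.

Lemma ore_delta1 i : ore_delta D i 1 = 0.
Proof.
apply: (addrI (ore_delta D i 1)).
by rewrite -{3}(mulr1 1) ore_deltaM rmorph1 mul1r mulr1 addr0.
Qed.

Lemma ore_endo_ext_const i (r : R) :
  ore_endo_ext i (ore_const r) = ore_const (ore_alpha D i r).
Proof. by rewrite /ore_endo_ext /ore_const map_mpolyZ map_mpolyX. Qed.

Lemma ore_endo_ext_var i j : ore_endo_ext i (ore_var j) = ore_var j.
Proof. exact: map_mpolyX. Qed.

Lemma ore_der_ext_const i (r : R) :
  ore_der_ext i (ore_const r) = ore_const (ore_delta D i r).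
Proof.
apply/mpolyP=> u; rewrite mcoeff_map_mpoly !mcoeffZ mcoeffX.
by case: (_ == u); rewrite ?mulr1 ?mulr0 ?raddf0.
Qed.

Lemma ore_der_ext_var i j : ore_der_ext i (ore_var j) = 0.
Proof.
apply/mpolyP=> u; rewrite mcoeff_map_mpoly mcoeffX mcoeff0.
by case: (_ == u); rewrite ?ore_delta1 ?raddf0.
Qed.

Lemma ore_var_exp i j : ore_var i ^+ j = ('X_[U_(i) *+ j] : {mpoly R[n]}).
Proof.
elim: j => [|j IH]; first by rewrite expr0 mulm0n.
rewrite exprS IH /= -[LHS]/(ore_mul D 'X_i 'X_[_]) ore_mul_term.
by rewrite mulmS mpolyXD.
Qed.

Lemma ore_stage0 k : ore_stage k 0.
Proof. by move=> t i _ _; rewrite mcoeff0. Qed.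

Lemma ore_stageD k p q : ore_stage k p -> ore_stage k q -> ore_stage k (p + q).
Proof.
by move=> Sp Sq t i ki ti; rewrite mcoeffD (Sp t i) // (Sq t i) // addr0.
Qed.

Lemma ore_stageZ k (r : R) p : ore_stage k p -> ore_stage k (r *: p).
Proof. by move=> Sp t i ki ti; rewrite mcoeffZ (Sp t i) // mulr0. Qed.

Lemma ore_stageX k t : (forall i : 'I_n, (k <= i)%N -> t i = 0%N) ->
  ore_stage k ('X_[t] : {mpoly R[n]}).
Proof.
move=> St s i ki si; rewrite mcoeffX; case: eqP => // ts.
by rewrite -ts (St i) in si.
Qed.

Lemma ore_stage_supp k p t : ore_stage k p -> t \in msupp (p : {mpoly R[n]}) ->
  forall i : 'I_n, (k <= i)%N -> t i = 0%N.
Proof.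
move=> Sp tp i ki; apply/eqP/negPn/negP=> ti; move: tp.
by rewrite mcoeff_msupp (Sp t i) // eqxx.
Qed.

Lemma ore_stage_sum (I : eqType) (l : seq I) (F : I -> ore_ext D) k :
  (forall i, i \in l -> ore_stage k (F i)) -> ore_stage k (\sum_(i <- l) F i).
Proof.
elim: l => [|i l IH] Sl; first by rewrite big_nil; exact: ore_stage0.
rewrite big_cons; apply: ore_stageD; first by apply: Sl; rewrite inE eqxx.
by apply: IH => j jl; apply: Sl; rewrite inE jl orbT.
Qed.

Lemma ore_stage_act k (i : 'I_n) q : (i < k)%N ->
  ore_stage k q -> ore_stage k (ore_act D i q).
Proof.
move=> ik Sq; apply: (@ore_stage_sum _ (msupp (q : {mpoly R[n]}))) => t tq.
have St := ore_stage_supp Sq tq.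
apply: ore_stageD; apply: ore_stageZ; apply: ore_stageX => j kj //.
  rewrite mnmDE St // mnm1E; case: eqP => // ij.
  by move: (leq_trans ik kj); rewrite ij ltnn.
exact: St.
Qed.

Lemma ore_stageM k p q : ore_stage k p -> ore_stage k q -> ore_stage k (p * q).
Proof.
move=> Sp Sq; apply: (@ore_stage_sum _ (msupp (p : {mpoly R[n]}))) => t tp.
have St := ore_stage_supp Sp tp; apply: ore_stageZ.
rewrite /ore_term_act; elim: (enum _) => //= i e IH.
case: (ltnP i k) => ik; last by rewrite St.
by elim: (t i) => //= j; exact: ore_stage_act.
Qed.

Lemma ore_stage_subring k : subring (ore_stage k).
Proof.
split; last exact: ore_stageM.
  by apply: ore_stageX => i _; rewrite mnm0E.
by move=> p q Sp Sq t i ki ti; rewrite mcoeffB (Sp t i) // (Sq t i) // subr0.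
Qed.

Lemma ore_ext_tactC (i : 'I_n) t (f : {additive R -> R}) q :
  (forall j x, j != i -> f (ore_alpha D j x) = ore_alpha D j (f x)) ->
  (forall j x, j != i -> f (ore_delta D j x) = ore_delta D j (f x)) ->
  t i = 0%N ->
  map_mpoly f (ore_term_act D t q) = ore_term_act D t (map_mpoly f q).
Proof.
move=> fa fd ti0.
have fZ c s : map_mpoly f (c *: 'X_[s] : {mpoly R[n]}) = f c *: 'X_[s].
  apply/mpolyP=> u; rewrite mcoeff_map_mpoly !mcoeffZ !mcoeffX.
  by case: eqP; rewrite ?mulr1 ?mulr0 ?raddf0.
rewrite /ore_term_act; elim: (enum _) => //= j e <-.
case: (eqVneq j i) => [->|ji]; first by rewrite ti0.
elim: (t j) => //= k <-; move: (iter k _ _).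
apply: mpoly_eq_on_terms => [x y|x y|c s]; rewrite ?raddfD /= ?ore_actD //=.
  by rewrite raddfD.
by rewrite fZ !ore_actX raddfD /= !fZ fa // fd.
Qed.

Lemma ore_endo_extM (i : 'I_n) p q : ore_stage i p ->
  ore_endo_ext i (p * q) = ore_endo_ext i p * ore_endo_ext i q.
Proof.
move=> Sp; pose P t := t i = 0%N.
apply: (@mpoly_eq_on_terms_in R n _ P
  (fun p : {mpoly R[n]} => map_mpoly (ore_alpha D i) (ore_mul D p q))
  (fun p => ore_mul D (map_mpoly (ore_alpha D i) p)
                      (map_mpoly (ore_alpha D i) q))) => [x y|x y|c t Pt|t tp].
- by rewrite ore_mulDl raddfD.
- by rewrite raddfD ore_mulDl.
- rewrite map_mpolyZ map_mpolyX !ore_mulX map_mpolyZ (ore_ext_tactC (i := i)) //.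
    by move=> j x _; exact: ore_alphaC.
  by move=> j x ji; exact: ore_alpha_delta.
exact: (ore_stage_supp Sp tp).
Qed.

Lemma ore_der_extM (i : 'I_n) p q : ore_stage i p ->
  ore_der_ext i (p * q) =
  ore_endo_ext i p * ore_der_ext i q + ore_der_ext i p * q.
Proof.
move=> Sp; pose P t := t i = 0%N.
have dZ c x : map_mpoly (ore_delta D i) (c *: x : {mpoly R[n]}) =
    ore_alpha D i c *: map_mpoly (ore_delta D i) x + ore_delta D i c *: x.
  apply/mpolyP=> u; rewrite mcoeffD !(mcoeff_map_mpoly, mcoeffZ).
  exact: ore_deltaM.
apply: (@mpoly_eq_on_terms_in R n _ P
  (fun p : {mpoly R[n]} => map_mpoly (ore_delta D i) (ore_mul D p q))
  (fun p => ore_mul D (map_mpoly (ore_alpha D i) p)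
                      (map_mpoly (ore_delta D i) q)
            + ore_mul D (map_mpoly (ore_delta D i) p) q))
  => [x y|x y|c t Pt|t tp].
- by rewrite ore_mulDl raddfD.
- by rewrite !raddfD /= !ore_mulDl addrACA.
- rewrite map_mpolyZ map_mpolyX !ore_mulX dZ (ore_ext_tactC (i := i)) //.
  + congr (_ + _); rewrite dZ.
    have -> : map_mpoly (ore_delta D i) ('X_[t] : {mpoly R[n]}) = 0.
      apply/mpolyP=> u; rewrite mcoeff_map_mpoly mcoeffX mcoeff0.
      by case: (t == u); rewrite ?ore_delta1 ?raddf0.
    by rewrite scaler0 add0r ore_mulX.
  + by move=> j x ji; rewrite -ore_alpha_delta // eq_sym.
  + by move=> j x _; exact: ore_deltaC.
exact: (ore_stage_supp Sp tp).
Qed.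

Lemma ore_var_comm (i : 'I_n) p :
  ore_var i * p = ore_endo_ext i p * ore_var i + ore_der_ext i p.
Proof.
rewrite -[LHS]/(ore_mul D 'X_i p) -['X_i]scale1r ore_mulX scale1r tactU.
rewrite -[RHS]/(ore_mul D (ore_endo_ext i p) 'X_i + ore_der_ext i p).
rewrite ore_mul_term /ore_endo_ext /ore_der_ext.
move: p; apply: (@mpoly_eq_on_terms R n _ (ore_act D i)
  (fun p : {mpoly R[n]} => map_mpoly (ore_alpha D i) p * 'X_i
                           + map_mpoly (ore_delta D i) p)) => [x y|x y|c t].
- exact: ore_actD.
- by rewrite !raddfD /= mulrDl addrACA.
rewrite ore_actX map_mpolyZ map_mpolyX -scalerAl -mpolyXD; congr (_ + _).
apply/mpolyP=> u; rewrite mcoeff_map_mpoly !mcoeffZ mcoeffX.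
by case: (t == u); rewrite ?mulr1 ?mulr0 ?raddf0.
Qed.

Lemma ore_stageMvar (k : 'I_n) d (s : 'I_d -> ore_ext D) (j : 'I_d) t :
  (forall j, ore_stage k (s j)) -> t k = 0%N ->
  mcoeff (t + U_(k) *+ j) (\sum_(l < d) s l * ore_var k ^+ l) = mcoeff t (s j).
Proof.
move=> Ss tk.
have E l : s l * ore_var k ^+ l = (s l : {mpoly R[n]}) * 'X_[U_(k) *+ l].
  by rewrite ore_var_exp -[LHS]/(ore_mul D _ _) ore_mul_term.
rewrite (eq_bigr _ (fun l _ => E l)) -[LHS]/(mcoeff _ (\sum_(l < d) _)).
rewrite raddf_sum (bigD1 j) //= addmC mcoeffMX big1 ?addr0 // => l lj.
apply/eqP; rewrite mcoeff_eq0 (perm_mem (msuppMX _ _)).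
apply/mapP=> -[u us /mnmP/(_ k)]; rewrite !mnmDE !mulmnE !mnm1E eqxx !mul1n tk.
rewrite (ore_stage_supp (Ss l) us) // !addn0 => /esym/val_inj lj'.
by rewrite lj' eqxx in lj.
Qed.

Theorem ore_ext_tower (k : 'I_n) :
  is_ore_extension (ore_stage k) (ore_stage k.+1) (ore_var k)
    (ore_endo_ext k) (ore_der_ext k).
Proof.
split.
- exact: ore_stage_subring.
- exact: ore_stage_subring.
- by move=> p Sp t i ki ti; rewrite mcoeff_map_mpoly (Sp t i) ?raddf0.
- exact: map_mpolyX.
- by move=> p q _ _; exact: raddfD.
- by move=> p q Sp _; exact: ore_endo_extM.
- move=> p q _ _ /mpolyP pq; apply/mpolyP=> t; apply: (@ore_alpha_inj _ _ D k).
  by have := pq t; rewrite !mcoeff_map_mpoly.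
- by move=> p Sp t i ki ti; rewrite mcoeff_map_mpoly (Sp t i) ?raddf0.
- by move=> p q _ _; exact: raddfD.
- by move=> p q Sp _; exact: ore_der_extM.
- by move=> p _; exact: ore_var_comm.
- move=> b; split=> [Sb|[d [s [Ss ->]]]]; last first.
    apply: ore_stage_sum => j _; apply: ore_stageM.
      by move=> t i ki; apply: Ss; exact: ltnW.
    rewrite ore_var_exp; apply: ore_stageX => i ki; rewrite mulmnE mnm1E.
    by case: eqP => // eki; rewrite -eki ltnn in ki.
  pose d := (\max_(t <- msupp (b : {mpoly R[n]})) t k).+1.
  pose s (j : 'I_d) : {mpoly R[n]} :=
    \sum_(t <- msupp (b : {mpoly R[n]}) | t k == j)
       mcoeff t b *: 'X_[t - U_(k) *+ j].
  exists d, s; split=> [j|].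
    rewrite /s -big_filter; apply: ore_stage_sum => t.
    rewrite mem_filter => /andP[/eqP tj tb]; apply: ore_stageZ.
    apply: ore_stageX => i ki; rewrite mnmBE mulmnE mnm1E.
    case: (eqVneq k i) => [<-|nki]; first by rewrite mul1n tj subnn.
    rewrite mul0n subn0; apply: (ore_stage_supp Sb tb).
    by rewrite ltn_neqAle nki.
  have E j : (s j : ore_ext D) * ore_var k ^+ j = s j * 'X_[U_(k) *+ j].
    by rewrite ore_var_exp -[LHS]/(ore_mul D _ _) ore_mul_term.
  rewrite (eq_bigr _ (fun j _ => E j)).
  rewrite [LHS](mpolyE (b : {mpoly R[n]})) -[RHS]/(\sum_(j < d) (_ : {mpoly R[n]})).
  under [RHS]eq_bigr => j _ do rewrite mulr_suml.
  rewrite (exchange_big_dep xpredT) //= big_seq [RHS]big_seq.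
  apply: eq_bigr => t tb.
  have td : (t k < d)%N by rewrite ltnS; exact: (leq_bigmax_seq (F := fun t : 'X_{1..n} => t k)).
  rewrite (big_pred1 (Ordinal td)) => [|j]; last first.
    by apply/eqP/eqP => [tj|->//]; apply/val_inj.
  rewrite -scalerAl -mpolyXD submK //=; apply/mnm_lepP=> i.
  by rewrite mulmnE mnm1E; case: eqP => [->|_]; rewrite ?mul1n ?mul0n.
- move=> d s Ss s0 j; apply/mpolyP=> t; rewrite mcoeff0.
  case: (eqVneq (t k) 0%N) => tk; last by rewrite (Ss j t k).
  by rewrite -(ore_stageMvar j Ss tk) s0 mcoeff0.
Qed.

Lemma ore_stage_base p : ore_stage 0 p <-> exists r, p = ore_const r.
Proof.
split=> [Sp|[r ->]].
  exists (mcoeff 0%MM p); apply/mpolyP=> t; rewrite mcoeffZ mcoeffX.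
  case: eqP => [<-|t0]; first by rewrite mulr1.
  rewrite mulr0; case: (boolP [forall i, t i == 0%N]) => [/forallP t_0|].
    by case: t0; apply/mnmP=> i; rewrite mnm0E (eqP (t_0 i)).
  by rewrite negb_forall => /existsP[i ti]; exact: (Sp t i).
by apply: ore_stageZ; apply: ore_stageX => i _; rewrite mnm0E.
Qed.

Lemma ore_stage_top p : ore_stage n p.
Proof. by move=> t i ni; rewrite leqNgt ltn_ord in ni. Qed.

Lemma ore_term_prod t :
  (\prod_(i < n) ore_var i ^+ t i) = ('X_[t] : {mpoly R[n]}) :> ore_ext D.
Proof.
rewrite [in RHS](multinomUE_id t).
rewrite (eq_bigr _ (fun i _ => ore_var_exp i (t i))).
elim: (index_enum _) => [|i e IH]; rewrite ?big_nil ?big_cons //.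
by rewrite IH -[LHS]/(ore_mul D _ _) ore_mul_term -mpolyXD.
Qed.

Lemma graded_mul_monomials (a b : R) t s :
  graded_mul D (a *: 'X_[t]) (b *: 'X_[s]) =
  (a * alpha_term D t b) *: 'X_[t + s].
Proof.
have aD u : {morph alpha_term D u : x y / x + y}.
  move=> x y; rewrite /alpha_term; elim: (enum _) => //= i e ->.
  by elim: (u i) => //= k ->; rewrite raddfD.
have E u x : \sum_(v <- msupp (b *: 'X_[s] : {mpoly R[n]}))
    (x * alpha_term D u (b *: 'X_[s])@_v) *: 'X_[u + v] =
    (x * alpha_term D u b) *: 'X_[u + s].
  apply: (extX (f := fun v y => (x * alpha_term D u y) *: 'X_[u + v])).
  by move=> v y z; rewrite aD mulrDr scalerDl.
rewrite /graded_mul (eq_bigr _ (fun u _ => E u _)).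
apply: (extX (f := fun u x => (x * alpha_term D u b) *: 'X_[u + s])).
by move=> u y z; rewrite mulrDl scalerDl.
Qed.

End OreTower.

Definition mterm (n m : nat) : Type := ('X_{1..n} * 'I_m)%type.
HB.instance Definition _ n m := Choice.on (mterm n m).

(* l o t o r *)
Definition mterm_mul n m (l : 'X_{1..n}) (t : mterm n m) (r : 'X_{1..n}) :
  mterm n m := ((l + t.1 + r)%MM, t.2).

Definition strict_well_order (T : eqType) (lt : rel T) : Prop :=
  [/\ irreflexive lt, transitive lt, forall s t, s != t -> lt s t || lt t s
    & well_founded (fun s t => lt s t)].

Definition term_ordering n (lt : rel 'X_{1..n}) : Prop :=
  strict_well_order lt /\
  forall u s t : 'X_{1..n}, lt s t -> lt (u + s)%MM (u + t)%MM.

Definition compatible_term_ordering n m (ltT : rel 'X_{1..n})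
    (lt : rel (mterm n m)) : Prop :=
  [/\ strict_well_order lt,
      forall (u v : 'X_{1..n}) (t : mterm n m),
        ltT u v -> lt (mterm_mul u t 0%MM) (mterm_mul v t 0%MM)
    & forall (u : 'X_{1..n}) (s t : mterm n m),
        lt s t -> lt (mterm_mul u s 0%MM) (mterm_mul u t 0%MM)].

Section Modules.
Variables (R : nzRingType) (n m : nat) (D : ore_data R n).
Local Notation V := 'rV[ore_ext D]_m.
Implicit Types (f g : V) (I G : V -> Prop) (t : mterm n m).

Definition left_module I : Prop :=
  [/\ I 0, forall f g, I f -> I g -> I (f + g)
     & forall (p : ore_ext D) f, I f -> I (p *: f)].

Definition bilateral_module I : Prop :=
  left_module I /\
  forall f (p : ore_ext D), I f -> I (map_mx (fun x => x * p) f).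

Definition mterm_coef f t : R := mcoeff t.1 (f 0 t.2).

Definition mterm_supp f : seq (mterm n m) :=
  [seq (u, j) | j <- enum 'I_m, u <- msupp (f 0 j)].

Definition monomial (c : R) t : V :=
  \row_j (if j == t.2 then (c *: 'X_[t.1] : {mpoly R[n]}) else 0).

(* (p . f) and (f . p) for the product of the associated graded ring, which
   has the same left R-module as ore_ext D. *)
Definition graded_lmul (p : {mpoly R[n]}) f : V :=
  map_mx (fun x : ore_ext D => graded_mul D p x) f.
Definition graded_rmul f (p : {mpoly R[n]}) : V :=
  map_mx (fun x : ore_ext D => graded_mul D x p) f.

Variable lt : rel (mterm n m).

(* None exactly when f = 0, provided lt is a strict total order. *)
Definition max_term f : option (mterm n m) :=
  ohead [seq t <- mterm_supp f | all (fun s => (s == t) || lt s t) (mterm_supp f)].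

Definition max_coef f : R :=
  if max_term f is Some t then mterm_coef f t else 0.

Definition max_monomial f : V :=
  if max_term f is Some t then monomial (max_coef f) t else 0.

(* max_monomial f is the sum over i of
   a_i l_i . max_monomial (g_i) . b_i r_i in the associated graded module. *)
Definition weak_representation G f (k : nat) (a b : 'I_k -> R)
    (l r : 'I_k -> 'X_{1..n}) (g : 'I_k -> V) : Prop :=
  (forall i, [/\ G (g i), a i != 0, b i != 0
     & omap (fun t => mterm_mul (l i) t (r i)) (max_term (g i)) = max_term f]) /\
  max_monomial f =
    \sum_(i < k) graded_rmul
       (graded_lmul (a i *: 'X_[l i]) (max_monomial (g i)))
       (b i *: 'X_[r i]).

Definition bilateral_weak_groebner_basis I G : Prop :=
  (forall g, G g -> I g /\ g <> 0) /\
  forall f, I f -> f <> 0 -> exists k a b l r h,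
    @weak_representation G f k a b l r h.

Definition left_weak_groebner_basis I G : Prop :=
  (forall g, G g -> I g /\ g <> 0) /\
  forall f, I f -> f <> 0 -> exists k a l h,
    @weak_representation G f k a (fun=> 1) l (fun=> 0%MM) h.

Definition lc_ideal I t (c : R) : Prop :=
  c = 0 \/ exists2 f, I f & max_term f = Some t /\ max_coef f = c.

Definition left_essential (c : mterm n m -> R) t : Prop :=
  ~ left_span (fun x => exists l w,
      [/\ w != t, t = mterm_mul l w 0%MM & x = alpha_term D l (c w)]) (c t).

Definition bilateral_essential (c : mterm n m -> R) t : Prop :=
  ~ left_span (fun x => exists l w r,
      [/\ w != t, t = mterm_mul l w r & x = alpha_term D l (c w)]) (c t).

End Modules.

(* Main.v *)
Require Import Defs.
From HB Require Import structures.
From mathcomp Require Import all_boot all_order all_algebra.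
From mathcomp Require Import mpoly.
From Stdlib Require Import Classical_Prop.

Set Implicit Arguments.
Unset Strict Implicit.
Unset Printing Implicit Defensive.

Import GRing.Theory.
Local Open Scope ring_scope.

(** Well-founded induction on t shows that c t lies in the left ideal generated
    by the alpha_l (c w) with w essential and t = l o w o r: if t is not itself
    essential, then c t is a left combination of elements alpha_l (c w) with
    t = l o w o r and w <> t; such a w is smaller than t, and alpha_l carries a
    combination for c w to one for alpha_l (c w).  Since
    (a l) . (c_w w) . r = a alpha_l(c_w) (l o w o r), a left combination of such
    generators equal to lc(f) is a weak representation of M(f), in which all
    right coefficients are 1. *)

(** * Left ideals spanned by a set *)

Lemma left_span_ideal (R : nzRingType) (A : R -> Prop) :
  left_ideal (left_span A).
Proof.
split.
- exists 0%N, (fun=> 0), (fun=> 0); split; last by rewrite big_ord0.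
  by case.
- move=> _ _ [k [r [a [Aa ->]]]] [k' [r' [a' [Aa' ->]]]].
  pose glue (u : 'I_k -> R) (v : 'I_k' -> R) i :=
    match split i with inl j => u j | inr j => v j end.
  have gl u v j : glue u v (lshift k' j) = u j.
    by rewrite /glue (unsplitK (inl j)).
  have gr u v j : glue u v (rshift k j) = v j.
    by rewrite /glue (unsplitK (inr j)).
  exists (k + k')%N, (glue r r'), (glue a a'); split.
    by move=> i; rewrite /glue; case: split.
  rewrite big_split_ord /=.
  by congr (_ + _); apply: eq_bigr => i _; rewrite ?gl ?gr.
move=> s _ [k [r [a [Aa ->]]]]; exists k, (fun i => s * r i), a; split=> //.
by rewrite mulr_sumr; apply: eq_bigr => i _; rewrite mulrA.
Qed.

Lemma left_span0 (R : nzRingType) (A : R -> Prop) : left_span A 0.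
Proof. by have [] := left_span_ideal A. Qed.

Lemma left_span_gen (R : nzRingType) (A : R -> Prop) x : A x -> left_span A x.
Proof.
move=> Ax; exists 1%N, (fun=> 1), (fun=> x); split=> //.
by rewrite big_ord1 mul1r.
Qed.

Lemma left_span_min (R : nzRingType) (A J : R -> Prop) :
  left_ideal J -> (forall x, A x -> J x) -> forall x, left_span A x -> J x.
Proof.
move=> [J0 JD JM] AJ _ [k [r [a [Aa ->]]]].
by apply: big_ind => // i _; apply/JM/AJ.
Qed.

(** Weak representations demand nonzero left coefficients, so the sum is reindexed over the support
    of [r]. *)
Lemma left_span_neq0 (R : nzRingType) (A : R -> Prop) x :
  left_span A x -> exists (k : nat) (r a : 'I_k -> R),
    [/\ forall i, r i != 0, forall i, A (a i) & x = \sum_(i < k) r i * a i].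
Proof.
move=> [k [r [a [Aa ->]]]]; pose S := [set i | r i != 0].
exists #|S|, (fun j => r (enum_val j)), (fun j => a (enum_val j)); split=> //.
  by move=> j; have := enum_valP j; rewrite inE.
rewrite -(big_enum_val (fun i => r i * a i)) [LHS](bigID (mem S)) /=.
by rewrite [X in _ + X]big1 ?addr0 // => i; rewrite inE negbK => /eqP->; rewrite mul0r.
Qed.

(** * The ring endomorphisms attached to terms *)

Section AlphaTerm.
Variables (R : nzRingType) (n : nat) (D : ore_data R n).
Local Notation alpha := (alpha_term D).

Lemma alpha_termD t : {morph alpha t : x y / x + y}.
Proof.
rewrite /alpha_term => x y; elim: (enum _) => //= i e ->.
by elim: (t i) => //= k ->; rewrite rmorphD.
Qed.

Lemma alpha_termM t : {morph alpha t : x y / x * y}.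
Proof.
rewrite /alpha_term => x y; elim: (enum _) => //= i e ->.
by elim: (t i) => //= k ->; rewrite rmorphM.
Qed.

Lemma alpha_term_const0 t : alpha t 0 = 0.
Proof. by apply: (addrI (alpha t 0)); rewrite -alpha_termD !addr0. Qed.

Lemma alpha_term_const1 t : alpha t 1 = 1.
Proof.
rewrite /alpha_term; elim: (enum _) => //= i e ->.
by elim: (t i) => //= k ->; rewrite rmorph1.
Qed.

Lemma alpha_term0 x : alpha 0%MM x = x.
Proof. by rewrite /alpha_term; elim: (enum _) => //= i e ->; rewrite mnm0E. Qed.

Lemma iter_alphaC k l i j x :
  iter k (ore_alpha D i) (iter l (ore_alpha D j) x) =
  iter l (ore_alpha D j) (iter k (ore_alpha D i) x).
Proof.
have iterC y : iter k (ore_alpha D i) (ore_alpha D j y) =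
    ore_alpha D j (iter k (ore_alpha D i) y).
  by elim: k => //= k ->; rewrite ore_alphaC.
by elim: l => //= l IH; rewrite iterC IH.
Qed.

(** The endomorphisms of different variables commute, so the powers of each one can be gathered. *)
Lemma alpha_term_add t s x : alpha (t + s)%MM x = alpha t (alpha s x).
Proof.
rewrite /alpha_term; elim: (enum _) => //= i e IH.
rewrite mnmDE iterD IH; congr iter.
move: (foldr _ x e) => y {IH}.
by elim: e => //= j e IHe; rewrite iter_alphaC IHe.
Qed.

End AlphaTerm.

(** * Monomials of the associated graded module *)

Section MonomialTheory.
Variables (R : nzRingType) (n m : nat) (D : ore_data R n).
Local Notation V := 'rV[ore_ext D]_m.

Lemma graded_mul0r (p : {mpoly R[n]}) : graded_mul D p 0 = 0.
Proof. by rewrite /graded_mul big1 // => t _; rewrite msupp0 big_nil. Qed.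

Lemma graded_mul0l (p : {mpoly R[n]}) : graded_mul D 0 p = 0.
Proof. by rewrite /graded_mul msupp0 big_nil. Qed.

(** A right factor with coefficient 1 changes only the term, because every [alpha_term] fixes 1. *)
Lemma graded_mul_monomial a l c (w : mterm n m) r :
  graded_rmul (graded_lmul (a *: 'X_[l]) (monomial D c w)) (1 *: 'X_[r]) =
  monomial D (a * alpha_term D l c) (mterm_mul l w r).
Proof.
apply/rowP=> j; rewrite !mxE /=; case: (j == w.2).
  by rewrite !graded_mul_monomials alpha_term_const1 mulr1.
by rewrite graded_mul0r graded_mul0l.
Qed.

Lemma mterm_coef_monomial c (t s : mterm n m) :
  mterm_coef (monomial D c t) s = if s == t then c else 0.
Proof.
rewrite /mterm_coef mxE -pair_eqE /= /pair_eq andbC.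
case: (s.2 == t.2); last by rewrite mcoeff0.
by rewrite mcoeffZ mcoeffX eq_sym; case: (s.1 == t.1); rewrite ?mulr1 ?mulr0.
Qed.

Lemma monomial_sum (t : mterm n m) k (x : 'I_k -> R) :
  monomial D (\sum_(i < k) x i) t = \sum_(i < k) monomial D (x i) t.
Proof.
apply/rowP=> j; rewrite summxE mxE; under [RHS]eq_bigr => i _ do rewrite mxE.
by case: (j == t.2); rewrite ?scaler_suml // big1.
Qed.

(** Comparing coefficients at [t] recovers the term, which a zero coefficient would hide. *)
Lemma max_term_monomial lt (g : V) c t :
  max_monomial lt g = monomial D c t -> c != 0 -> max_term lt g = Some t.
Proof.
rewrite /max_monomial; case: (max_term lt g) => [s|] E c0.
  congr Some; apply/eqP; apply: contra_neqT c0 => st.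
  have := congr1 (fun h => mterm_coef h t) E.
  by rewrite !mterm_coef_monomial eqxx eq_sym (negPf st).
have := congr1 (fun h => mterm_coef h t) E.
rewrite mterm_coef_monomial eqxx /mterm_coef mxE mcoeff0 => c0'.
by rewrite -c0' eqxx in c0.
Qed.

End MonomialTheory.

(** * Growth of terms under multiplication *)

(** If [u] were below the unit term, its powers would form an infinite descending chain. *)
Lemma term_ordering_gt0 n (ltT : rel 'X_{1..n}) :
  term_ordering ltT -> forall u, u != 0%MM -> ltT 0%MM u.
Proof.
move=> [[_ _ total wf] mono] u u0.
have /orP[u_lt0|//] := total _ _ u0.
exfalso; elim/(well_founded_ind wf): (0%MM : 'X_{1..n}) => v IH.
by apply: (IH (v + u)%MM); rewrite -{2}[v]addm0 mono.
Qed.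

(** Terms commute, so [l] and [r] merge into one left multiplier, which exceeds the unit term since
    it moves [w]. *)
Lemma mterm_mul_lt n m (ltT : rel 'X_{1..n}) (lt : rel (mterm n m)) :
  term_ordering ltT -> compatible_term_ordering ltT lt ->
  forall l w r, w != mterm_mul l w r -> lt w (mterm_mul l w r).
Proof.
move=> ordT [_ monoT _] l w r.
have mul0 : mterm_mul 0%MM w 0%MM = w.
  by rewrite /mterm_mul add0m addm0; case: w.
have -> : mterm_mul l w r = mterm_mul (l + r)%MM w 0%MM.
  by rewrite /mterm_mul addm0 -!addmA [(w.1 + r)%MM]addmC.
move=> ne; rewrite -{1}mul0; apply: monoT; apply: term_ordering_gt0 => //.
by apply: contra_neq ne => ->.
Qed.

(* P is the set of right multipliers: P r := (r = 0%MM) is the left case and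
   P r := True the bilateral one. *)
Section Essential.
Variables (R : nzRingType) (n m : nat) (D : ore_data R n).
Variables (ltT : rel 'X_{1..n}) (lt : rel (mterm n m)).
Hypothesis ordT : term_ordering ltT.
Hypothesis ordM : compatible_term_ordering ltT lt.
Variable P : 'X_{1..n} -> Prop.
Hypothesis P0 : P 0%MM.
Hypothesis PD : forall r s, P r -> P s -> P (r + s)%MM.
Variable c : mterm n m -> R.
Variable E : mterm n m -> Prop.
(** [E] is only characterised, so that it can be instantiated by [left_essential] and by
    [bilateral_essential]. *)
Hypothesis essentialE : forall t, E t <->
  ~ left_span (fun x => exists l w r,
      [/\ P r, w != t, t = mterm_mul l w r & x = alpha_term D l (c w)]) (c t).

Definition essential_gens t (x : R) : Prop :=
  exists l w r, [/\ P r, E w, t = mterm_mul l w r & x = alpha_term D l (c w)].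

Lemma left_span_essential_gens t : left_span (essential_gens t) (c t).
Proof.
have [[_ _ _ wf] _ _] := ordM.
elim/(well_founded_ind wf): t => t IH.
have [Et|/essentialE/NNPP] := classic (E t).
  apply: left_span_gen; exists 0%MM, t, 0%MM; split=> //; last first.
    by rewrite alpha_term0.
  by rewrite /mterm_mul add0m addm0; case: (t).
have [J0 JD JM] := left_span_ideal (essential_gens t).
apply: left_span_min => // _ [l [w [r [Pr ne tE ->]]]].
have lt_wt : lt w t by rewrite tE (mterm_mul_lt ordT ordM) -?tE.
(* The preimage of a left ideal under the ring endomorphism [alpha_term D l] is a left ideal, so it
   suffices to treat the generators for [w]. *)
apply: (left_span_min (J := fun x => left_span (essential_gens t)
  (alpha_term D l x)) _ _ (IH w lt_wt)).
  split=> [|x y|s x]; first by rewrite alpha_term_const0.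
    by rewrite alpha_termD; exact: JD.
  by rewrite alpha_termM; exact: JM.
move=> _ [l' [w' [r' [Pr' Ew' wE ->]]]].
apply: left_span_gen; exists (l + l')%MM, w', (r' + r)%MM; split=> //.
- exact: PD.
- by rewrite tE wE /mterm_mul /= !addmA.
by rewrite alpha_term_add.
Qed.

Variable I : 'rV[ore_ext D]_m -> Prop.
Variable f : mterm n m -> 'rV[ore_ext D]_m.
Hypothesis lc_principal :
  forall t x, lc_ideal lt I t x <-> principal_left_ideal (c t) x.
Hypothesis fE : forall t, E t ->
  I (f t) /\ max_monomial lt (f t) = monomial D (c t) t.

Lemma essential_neq0 t : E t -> c t != 0.
Proof.
move=> /essentialE Et; apply/eqP => ct0; apply: Et.
by rewrite ct0; exact: left_span0.
Qed.

Lemma essential_max_term t : E t -> max_term lt (f t) = Some t.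
Proof.
move=> Et; have [_ fM] := fE Et.
exact: (max_term_monomial fM (essential_neq0 Et)).
Qed.

(** The zero vector has empty support, hence no maximal term, whereas [f t] has maximal term [t]. *)
Lemma essential_mem g : (exists2 t, E t & g = f t) -> I g /\ g <> 0.
Proof.
move=> [t Et ->]; have [If _] := fE Et; split=> // f0.
have := essential_max_term Et; rewrite f0 /max_term.
suff -> : mterm_supp (0 : 'rV[ore_ext D]_m) = [::] by [].
rewrite /mterm_supp; elim: (enum _) => //= j e ->.
by rewrite mxE msupp0.
Qed.

(** The conclusion keeps [P (r i)] so that the left case can recover trivial right multipliers. *)
Lemma essential_representation g : I g -> exists k a l r h,
  (forall i, P (r i)) /\
  @weak_representation R n m D lt (fun g => exists2 t, E t & g = f t)
    g k a (fun=> 1) l r h.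
Proof.
move=> Ig; rewrite /weak_representation /max_monomial.
case gt: (max_term lt g) => [t|]; last first.
  (* With no maximal term, the maximal monomial is 0 by default and the empty sum represents it. *)
  exists 0%N, (fun=> 0), (fun=> 0%MM), (fun=> 0%MM), (fun=> 0).
  by split; [case|split; [case|rewrite big_ord0]].
have /lc_principal gc : lc_ideal lt I t (max_coef lt g) by right; exists g.
have {gc} : left_span (essential_gens t) (max_coef lt g).
  apply: left_span_min gc; first exact: left_span_ideal.
  by move=> _ ->; exact: left_span_essential_gens.
(* The factorisations of the finitely many generators are chosen simultaneously as functions of the
   index. *)
move=> /left_span_neq0[k [a [y [a0 /fin_all_exists[l]]]]].
move=> /fin_all_exists[w] /fin_all_exists[r lwr] ->.
exists k, a, l, r, (fun i => f (w i)); split; first by move=> i; case: (lwr i).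
split=> [i|].
  have [_ Ew tE _] := lwr i; split=> //; first by exists (w i).
    exact: oner_neq0.
  by rewrite essential_max_term //= -tE.
rewrite monomial_sum; apply: eq_bigr => i _.
have [_ Ew tE ->] := lwr i; have [_ fM] := fE Ew.
rewrite -/(max_monomial lt (f (w i))) fM.
by rewrite graded_mul_monomial -tE.
Qed.

End Essential.

Theorem proposition26
  (R : nzRingType) (n m : nat) (D : ore_data R n)
  (ltT : rel 'X_{1..n}) (lt : rel (mterm n m))
  (domR : GRing.integral_domain_axiom R)
  (noethR : noetherian R)
  (bezR : left_bezout R)
  (ordT : term_ordering ltT)
  (ordM : compatible_term_ordering ltT lt) :
  (forall (I : 'rV[ore_ext D]_m -> Prop) (c : mterm n m -> R)
          (f : mterm n m -> 'rV[ore_ext D]_m),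
     left_module I ->
     (forall t x, lc_ideal lt I t x <-> principal_left_ideal (c t) x) ->
     (forall t, left_essential D c t ->
        I (f t) /\ max_monomial lt (f t) = monomial D (c t) t) ->
     left_weak_groebner_basis lt I
       (fun g => exists2 t, left_essential D c t & g = f t))
  /\
  (forall (I : 'rV[ore_ext D]_m -> Prop) (c : mterm n m -> R)
          (f : mterm n m -> 'rV[ore_ext D]_m),
     bilateral_module I ->
     (forall t x, lc_ideal lt I t x <-> principal_left_ideal (c t) x) ->
     (forall t, bilateral_essential D c t ->
        I (f t) /\ max_monomial lt (f t) = monomial D (c t) t) ->
     bilateral_weak_groebner_basis lt I
       (fun g => exists2 t, bilateral_essential D c t & g = f t)).
Proof.
have span_mono (A B : R -> Prop) x :
    (forall y, A y -> B y) -> left_span A x -> left_span B x.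
  move=> AB; apply: left_span_min; first exact: left_span_ideal.
  by move=> y /AB; exact: left_span_gen.
split=> I c f _ lcI fE.
  (* The left case is recast with an explicit right multiplier constrained to be the unit term. *)
  have essE t : left_essential D c t <-> ~ left_span (fun x => exists l w r,
      [/\ r = 0%MM, w != t, t = mterm_mul l w r & x = alpha_term D l (c w)])
      (c t).
    split=> Et ct; apply: Et; apply: span_mono ct => y.
      by move=> [l [w [r [-> ne tE yE]]]]; exists l, w.
    by move=> [l [w [ne tE yE]]]; exists l, w, 0%MM.
  split=> [g|g Ig _]; first exact: (essential_mem essE fE).
  have PD (r s : 'X_{1..n}) : r = 0%MM -> s = 0%MM -> (r + s)%MM = 0%MM.
    by move=> -> ->; rewrite addm0.
  have [k [a [l [r [h [r0 rep]]]]]] :=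
    essential_representation ordT ordM erefl PD essE lcI fE Ig.
  exists k, a, l, h; have [repG gE] := rep.
  split=> [i|]; first by rewrite -(r0 i).
  by rewrite gE; apply: eq_bigr => i _; rewrite (r0 i).
(* Here the constraint on right multipliers is the trivial one. *)
have essE t : bilateral_essential D c t <-> ~ left_span (fun x => exists l w r,
    [/\ True, w != t, t = mterm_mul l w r & x = alpha_term D l (c w)]) (c t).
  split=> Et ct; apply: Et; apply: span_mono ct => y.
    by move=> [l [w [r [_ ne tE yE]]]]; exists l, w, r.
  by move=> [l [w [r [ne tE yE]]]]; exists l, w, r.
split=> [g|g Ig _]; first exact: (essential_mem essE fE).
have [k [a [l [r [h [_ rep]]]]]] := essential_representation
  ordT ordM (P := fun=> True) Logic.I (fun _ _ _ _ => Logic.I) essE lcI fE Ig.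
by exists k, a, (fun=> 1), l, r, h.
Qed.
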